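(* Let $(X,S)$ be a finite nondegenerate braided set and let $n$ be the number of elements of $X$. The rank of $(X,S)$ is less than or equal to $n$, with equality if and only if $(X,S)$ is symmetric.
   Context: Let $X$ be a nonempty set and $S:X\times X\to X\times X$ a bijection, written $S(x,y)=(g_x(y),f_y(x))$. $(X,S)$ is a braided set if $S_1S_2S_1=S_2S_1S_2$ on $X^3$, where $S_1=S\times \mathrm{id}$, $S_2=\mathrm{id}\times S$; it is nondegenerate if all maps $g_x$ and $f_y$ are bijections of $X$; it is finite if $X$ is finite. A braided set is symmetric if $S^2=\mathrm{id}_{X\times X}$. The structure group $G_X$ is the group generated by the elements of $X$ with relations $xy=y_1x_1$ whenever $S(x,y)=(y_1,x_1)$. The rank of a group $G$ having an abelian subgroup $\Gamma$ of finite index is defined as the rank of $\Gamma$ (this does not depend on the choice of $\Gamma$). When $(X,S)$ is a finite nondegenerate braided set, $G_X$ has an abelian subgroup of finite index, and the rank of $(X,S)$ is defined as the rank of $G_X$. *)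

(* Defs.v *)
From HB Require Import structures.
From mathcomp Require Import all_boot all_algebra.
From mathcomp Require Import boolp.

Set Implicit Arguments.
Unset Strict Implicit.
Unset Printing Implicit Defensive.

Local Open Scope quotient_scope.
Local Open Scope group_scope.

(* The group generated by X with relations u = v for R u v: words in X and the
   formal inverses, modulo the congruence generated by R and cancellation.
   The letter (x, false) is the generator x, and (x, true) is its inverse. *)

Section Presentation.
Variable X : choiceType.
Implicit Types (a : X * bool) (u v w : seq (X * bool)).

Definition letter_inv a : X * bool := (a.1, ~~ a.2).

Definition word_inv u := rev (map letter_inv u).

Inductive word_eq (R : seq (X * bool) -> seq (X * bool) -> Prop) :
    seq (X * bool) -> seq (X * bool) -> Prop :=
  | word_eq_rel u v of R u v : word_eq R u v
  | word_eq_cancel a : word_eq R [:: a; letter_inv a] [::]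
  | word_eq_refl u : word_eq R u u
  | word_eq_sym u v of word_eq R u v : word_eq R v u
  | word_eq_trans u v w of word_eq R u v & word_eq R v w : word_eq R u w
  | word_eq_cat u u' v v' of word_eq R u u' & word_eq R v v' :
      word_eq R (u ++ v) (u' ++ v').

Variable R : seq (X * bool) -> seq (X * bool) -> Prop.

Definition word_eqb u v : bool := `[< word_eq R u v >].

Lemma word_eqb_refl : reflexive word_eqb.
Proof. by move=> u; apply/asboolP/word_eq_refl. Qed.

Lemma word_eqb_sym : symmetric word_eqb.
Proof. by move=> u v; apply/asboolP/asboolP; exact: word_eq_sym. Qed.

Lemma word_eqb_trans : transitive word_eqb.
Proof.
by move=> v u w /asboolP uv /asboolP vw; apply/asboolP/(word_eq_trans uv vw).
Qed.

Canonical word_equiv : equiv_rel (seq (X * bool)) :=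
  EquivRel word_eqb word_eqb_refl word_eqb_sym word_eqb_trans.

Definition presented_group := {eq_quot word_equiv}.

HB.instance Definition _ := Choice.on presented_group.

Definition word_class u : presented_group := \pi_presented_group u.

Lemma word_classP u v : (word_class u = word_class v) <-> word_eq R u v.
Proof.
split=> [/eqP|uv]; last by apply/eqP; rewrite eqmodE; apply/asboolP.
by rewrite eqmodE => /asboolP.
Qed.

Lemma repr_word_class u : word_eq R (repr (word_class u)) u.
Proof. by apply/word_classP; rewrite /word_class reprK. Qed.

Lemma word_class_repr (g : presented_group) : word_class (repr g) = g.
Proof. exact: reprK. Qed.

Definition pres_one : presented_group := word_class [::].
Definition pres_mul (g h : presented_group) : presented_group :=
  word_class (repr g ++ repr h).
Definition pres_inv (g : presented_group) : presented_group :=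
  word_class (word_inv (repr g)).

Lemma pres_mulE u v :
  pres_mul (word_class u) (word_class v) = word_class (u ++ v).
Proof. by apply/word_classP/word_eq_cat; exact: repr_word_class. Qed.

Lemma letter_invK : involutive letter_inv.
Proof. by case=> x b; rewrite /letter_inv /= negbK. Qed.

Lemma word_inv_catl u : word_eq R (word_inv u ++ u) [::].
Proof.
elim: u => [|a u IHu]; first exact: word_eq_refl.
rewrite /word_inv /= rev_cons cat_rcons.
apply: word_eq_trans IHu; apply: word_eq_cat; first exact: word_eq_refl.
rewrite -[X in word_eq R _ X]/([::] ++ u) -[_ :: _]/([:: letter_inv a; a] ++ u).
apply: word_eq_cat; last exact: word_eq_refl.
by rewrite -{2}[a]letter_invK; exact: word_eq_cancel.
Qed.

Lemma pres_mulA : associative pres_mul.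
Proof.
move=> g h k; rewrite -(word_class_repr g) -(word_class_repr h).
by rewrite -(word_class_repr k) !pres_mulE catA.
Qed.

Lemma pres_mul1 : left_id pres_one pres_mul.
Proof. by move=> g; rewrite -(word_class_repr g) pres_mulE. Qed.

Lemma pres_mulr1 : right_id pres_one pres_mul.
Proof. by move=> g; rewrite -(word_class_repr g) pres_mulE cats0. Qed.

Lemma pres_mulV : left_inverse pres_one pres_inv pres_mul.
Proof.
move=> g; rewrite -[X in pres_mul _ X]word_class_repr pres_mulE.
exact/word_classP/word_inv_catl.
Qed.

Lemma pres_mulrV : right_inverse pres_one pres_inv pres_mul.
Proof.
move=> g; set h := pres_inv g.
rewrite -[LHS]pres_mul1 -{1}(pres_mulV h) -pres_mulA.
by rewrite [pres_mul h (pres_mul g h)]pres_mulA pres_mulV pres_mul1 pres_mulV.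
Qed.

HB.instance Definition _ :=
  isGroup.Build presented_group pres_mulA pres_mul1 pres_mulr1
    pres_mulV pres_mulrV.

End Presentation.

Section Rank.
Variable G : groupType.
Implicit Types (Gamma : {pred G}) (r : nat).

Definition expgz (x : G) (k : int) : G :=
  match k with Posz n => x ^+ n | Negz n => x ^- n.+1 end.

(* Only used for families of pairwise commuting elements, so the order of the
   factors is irrelevant. *)
Definition Zindependent r (e : 'I_r -> G) : Prop :=
  forall k : 'I_r -> int,
    \prod_(i < r) expgz (e i) (k i) = 1 -> forall i, k i = 0%R.

(* The rank of an abelian subgroup as an abelian group, i.e. the maximal number
   of Z-linearly independent elements. *)
Definition abelian_rank Gamma r : Prop :=
  (exists e : 'I_r -> G, (forall i, e i \in Gamma) /\ Zindependent e) /\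
  (forall m (e : 'I_m -> G),
     (forall i, e i \in Gamma) -> Zindependent e -> m <= r).

(* Gamma has finitely many left cosets: those of the elements of a list. *)
Definition finite_index Gamma : Prop :=
  exists s : seq G, forall g, exists2 t, t \in s & t^-1 * g \in Gamma.

Definition abelian_finite_index_subgroup Gamma : Prop :=
  [/\ group_closed Gamma, {in Gamma &, forall x y, commute x y} &
      finite_index Gamma].

(* r is the rank of the virtually abelian group G: an abelian subgroup of finite
   index exists, and each of them has rank r. *)
Definition group_rank r : Prop :=
  (exists Gamma, abelian_finite_index_subgroup Gamma) /\
  (forall Gamma, abelian_finite_index_subgroup Gamma -> abelian_rank Gamma r).

End Rank.

Section BraidedSet.
Variables (X : choiceType) (S : X * X -> X * X).

Definition braid1 (t : X * X * X) : X * X * X :=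
  let: (x, y, z) := t in (S (x, y), z).

Definition braid2 (t : X * X * X) : X * X * X :=
  let: (x, y, z) := t in (x, (S (y, z)).1, (S (y, z)).2).

Definition braided_set : Prop :=
  bijective S /\ braid1 \o braid2 \o braid1 =1 braid2 \o braid1 \o braid2.

(* S (x, y) = (g_x y, f_y x) *)
Definition braid_g (x y : X) : X := (S (x, y)).1.
Definition braid_f (y x : X) : X := (S (x, y)).2.

Definition nondegenerate : Prop :=
  (forall x, bijective (braid_g x)) /\ (forall y, bijective (braid_f y)).

Definition symmetric_set : Prop := S \o S =1 id.

Definition structure_rel (u v : seq (X * bool)) : Prop :=
  exists x y, u = [:: (x, false); (y, false)] /\
    v = [:: ((S (x, y)).1, false); ((S (x, y)).2, false)].

Definition structure_group : groupType := presented_group structure_rel.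

Definition braided_rank (r : nat) : Prop := group_rank structure_group r.

End BraidedSet.

(* Main.v *)
From mathcomp Require Import all_boot all_algebra.
From mathcomp Require Import boolp.
Require Import Defs.

(** Write [G] for the structure group, [h a] for the permutation of [X] by which
    [a : G] acts through the maps [g_x] (here [gact a]), and put
    [a (+) x := a * (h a)^-1 x]. This is the right action on [G] of the derived
    group of the solution: [S^2(x, y) = (sigma_z x, _)] for [z = g_x y], and
    the defining relations of [G] become
      [(a (+) x) (+) z = (a (+) z) (+) sigma_z x],
    that is, [x z = z (sigma_z x)] in the derived group ([oplusC]). Left
    multiplication respects it: [b * (a (+) x) = (b * a) (+) h_b x].

    In the derived group, [x^-N z x^N = (sigma_x)^N z], so a power [x^N] with
    [(sigma_x)^N = 1] is central; and [z^-1 x^N z = (sigma_z x)^N], so it depends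
    only on the class of [x] under the maps [sigma_z]. The matching elements of
    [G] are found by pigeonhole: let [p_k x = 1 (+) x (+) ... (+) x] ([k] terms). There are
    [i < j] such that, for every [x], the elements [p_i x] and [p_j x] act
    alike and [(sigma_x)^i = (sigma_x)^j]. Then
    [kappa x := p_j x * (p_i x)^-1] acts trivially on [X], and moving letters past
    each other gives [a * kappa x * a^-1 = kappa (h_a x)] ([mul_kappa_swap]) and
    [kappa (sigma_z x) = kappa x] ([kappa_sigma]). The first identity shows that the
    [kappa x] commute and generate a normal subgroup [Kappa]. Its index is
    finite: modulo [Kappa], a word with [j] occurrences of one letter can be
    shortened, so words of bounded length represent all cosets.

    The rank of a group does not depend on the abelian subgroup of finite index,
    since powers move an independent family from one to another ([group_rank_of]).
    As [Kappa] is generated by the [#|X|] elements [kappa x], the rank is at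
    most [#|X|]. If [S] is not symmetric, then [sigma_z x <> x] for some
    [x], [z]; two of the generators coincide and the rank is at most [#|X| - 1].
    If [S] is symmetric, then [G] has a 1-cocycle with values in the free
    abelian group on [X] sending each generator to itself ([count]); it maps
    [kappa x] to [j - i] times [x], so the [kappa x] are independent. *)

Set Implicit Arguments.
Unset Strict Implicit.
Unset Printing Implicit Defensive.

Import GRing.Theory Num.Theory.
Local Open Scope group_scope.

(** * Integer relations and integer combinations *)

Section Dependence.
Local Open Scope ring_scope.

(** A nonzero rational vector in the left kernel, scaled by its denominators. *)
Lemma int_relation m s (A : 'M[int]_(m, s)) :
  (s < m)%N -> exists2 l : 'rV[int]_m, l != 0 & l *m A = 0.
Proof.
move=> ltsm; pose B := map_mx (intr : int -> rat) A.
(* The rank of [B] is at most [s < m]. *)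
have kerB_neq0 : kermx B != 0.
  by rewrite -mxrank_eq0 mxrank_ker subn_eq0 -ltnNge (leq_ltn_trans (rank_leq_col B)).
have [u uB u_neq0] := rowV0Pn kerB_neq0.
pose N := \prod_j denq (u 0 j).
have N_neq0 : N != 0 by apply/prodf_neq0 => j _; rewrite denq_neq0.
have uN j : exists z : int, u 0 j * N%:~R = z%:~R.
  exists (numq (u 0 j) * \prod_(i | i != j) denq (u 0 i)).
  rewrite /N (bigD1 j) //= !intrM mulrA; congr (_ * _).
  by rewrite -{1}[u 0 j]divq_num_den mulfVK // intr_eq0 denq_neq0.
have [l lE] := choice uN.
exists (\row_j l j).
  apply: contra_neq u_neq0 => l0; apply/rowP=> j; apply/eqP.
  have := lE j; move/rowP: l0 => /(_ j); rewrite !mxE => -> /eqP.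
  by rewrite mulf_eq0 [_%:~R == 0 :> rat]intr_eq0 (negPf N_neq0) orbF.
have: (u *m B) = 0 by apply/sub_kermxP.
move=> uB0; apply/rowP=> j; rewrite !mxE; apply/eqP.
rewrite -(intr_eq0 rat) rmorph_sum /=; apply/eqP.
transitivity ((u *m B) 0 j * N%:~R); last by rewrite uB0 mxE mul0r.
rewrite !mxE mulr_suml; apply: eq_bigr => i _.
by rewrite !mxE intrM -lE mulrAC.
Qed.

End Dependence.

Lemma nat_collision (T : finType) (f : nat -> T) :
  exists i j, i < j /\ f i = f j.
Proof.
have [/injectiveP fI | /injectivePn [i [j neq_ij fE]]] :=
  boolP (injectiveb (fun i : 'I_#|T|.+1 => f i)).
  by have := leq_card _ fI; rewrite card_ord ltnn.
have : (i : nat) != j by [].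
by rewrite neq_ltn => /orP [] ?; [exists i, j | exists j, i].
Qed.

Section IntegerPowers.
Variable G : groupType.
Implicit Types (x y : G) (k l : int).

Lemma commute_expgz x y k : commute x y -> commute x (expgz y k).
Proof. by move=> xy; case: k => n; [|apply: commuteV]; apply: commuteX. Qed.

Lemma expgzS x k : expgz x (k + 1)%R = expgz x k * x.
Proof.
case: k => n; first by rewrite -PoszD addn1 /= expgSr.
rewrite NegzE intS opprD -addrA [(_ + 1)%R]addrC addrA subrr add0r.
case: n => [|n] /=; first by rewrite mulVg.
by rewrite [x ^+ n.+2]expgS invgM mulgVK.
Qed.

Lemma expgzB1 x k : expgz x (k - 1)%R = expgz x k * x^-1.
Proof. by rewrite -{2}[k](subrK 1%R) expgzS mulgK. Qed.

Lemma expgzD x k l : expgz x (k + l)%R = expgz x k * expgz x l.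
Proof.
elim/int_rec: l => [|n IHn|n IHn]; first by rewrite addr0 mulg1.
  by rewrite intS [(1 + _)%R]addrC addrA !expgzS IHn mulgA.
by rewrite intS opprD [(- _ + _)%R]addrC addrA !expgzB1 IHn mulgA.
Qed.

Lemma expgzB x k l : expgz x (k - l)%R = expgz x k * (expgz x l)^-1.
Proof. by apply: (mulIg (expgz x l)); rewrite mulgVK -expgzD subrK. Qed.

Lemma expgzM x k l : expgz x (k * l)%R = expgz (expgz x k) l.
Proof.
elim/int_rec: l => [|n IHn|n IHn]; first by rewrite mulr0.
  by rewrite intS [(1 + _)%R]addrC mulrDr mulr1 expgzD expgzS IHn.
by rewrite intS opprD [(- _ + _)%R]addrC expgzB1 mulrBr mulr1 expgzB IHn.
Qed.

End IntegerPowers.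

(** If the [c i] commute, [combination c] is a morphism from the additive group of
    exponent functions. *)
Section Combinations.
Variables (G : groupType) (I : finType) (c : I -> G).
Hypothesis c_comm : forall i j, commute (c i) (c j).
Implicit Types (d : I -> int).

Definition combination d : G := \prod_i expgz (c i) (d i).

Lemma combinationD d1 d2 :
  combination (fun i => d1 i + d2 i)%R = combination d1 * combination d2.
Proof.
rewrite /combination -prodgM_commute => [|i j _ _].
  by apply: eq_bigr => i _; rewrite expgzD.
by apply/commute_expgz/commute_sym/commute_expgz.
Qed.

Lemma combination0 d : (forall i, d i = 0%R) -> combination d = 1.
Proof. by move=> d0; rewrite /combination big1 // => i _; rewrite d0. Qed.

Lemma combinationN d : combination (fun i => - d i)%R = (combination d)^-1.
Proof.
apply: (mulIg (combination d)); rewrite mulVg -combinationD combination0 // => i.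
by rewrite addNr.
Qed.

Lemma combinationZ d (l : int) :
  combination (fun i => l * d i)%R = expgz (combination d) l.
Proof.
have combX d' n : combination (fun i => n%:Z * d' i)%R = combination d' ^+ n.
  elim: n => [|n IHn]; first by rewrite combination0 // => i; rewrite mul0r.
  rewrite expgS -IHn -combinationD; apply: eq_bigr => i _.
  by rewrite intS mulrDl mul1r.
case: l => n; first exact: combX.
rewrite [RHS]/= -combX -combinationN; apply: eq_bigr => i _.
by rewrite NegzE mulNr.
Qed.

Lemma combination_sum (J : finType) (d : J -> I -> int) :
  \prod_j combination (d j) = combination (fun i => \sum_j d j i)%R.
Proof.
rewrite /=; elim: (index_enum J) => [|j s IHs].
  by rewrite big_nil combination0 // => i; rewrite big_nil.
rewrite big_cons IHs -combinationD; apply: eq_bigr => i _.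
by rewrite big_cons.
Qed.

Lemma combination_commute d1 d2 : commute (combination d1) (combination d2).
Proof.
apply: commute_prod => i _; apply/commute_sym/commute_prod => j _.
by apply/commute_expgz/commute_sym/commute_expgz.
Qed.

Lemma combination_single i0 (l : int) :
  combination (fun i => if i == i0 then l else 0)%R = expgz (c i0) l.
Proof.
rewrite /combination (eq_bigr (fun i => if i == i0 then expgz (c i0) l else 1)).
  elim: (index_enum I) (mem_index_enum i0) (index_enum_uniq I) => //= i s IHs.
  rewrite big_cons in_cons; case: eqVneq => [-> _ /andP [i0s _]|_ /= i0s /andP [_]].
    rewrite big1_seq ?mulg1 // => j /andP[_ js].
    by case: eqP js i0s => // -> ->.
  by rewrite mul1g => /IHs; apply.
by move=> i _; case: eqVneq => [->|].
Qed.

(** The exponents of [e] on [A] form a matrix with [m] rows and [#|A|] columns, so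
    [m > #|A|] would give an integer relation. Restricting the support to [A] is
    what yields a strict bound when two generators of a subgroup coincide. *)
Lemma independent_le (A : {set I}) m (e : 'I_m -> G) :
    (forall j, exists2 d, (forall i, i \notin A -> d i = 0%R)
                        & e j = combination d) ->
  Zindependent e -> m <= #|A|.
Proof.
move=> eA e_ind; rewrite leqNgt; apply/negP => ltAm.
have dex j : exists d, (forall i, i \notin A -> d i = 0%R) /\ e j = combination d.
  by have [d dA eE] := eA j; exists d.
have [d dP] := choice dex.
have [l l_neq0 lA0] := int_relation
  (\matrix_(j < m, k < #|A|) d j (enum_val k))%R ltAm.
case/negP: l_neq0; apply/eqP/rowP => j; rewrite mxE.
apply: (e_ind (fun j => l 0%R j)) => {j}.
rewrite (eq_bigr (fun j => combination (fun i => l 0 j * d j i)%R)) => [|j _].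
  rewrite combination_sum combination0 // => i.
  have [iA|iNA] := boolP (i \in A); last first.
    by rewrite big1 // => j _; rewrite (dP j).1 ?mulr0.
  have /rowP/(_ (enum_rank_in iA i)) := lA0; rewrite !mxE.
  by under eq_bigr => j _ do rewrite mxE enum_rankK_in //.
by rewrite combinationZ -(dP j).2.
Qed.

End Combinations.

(** * Independence of the rank from the subgroup *)

Section FiniteIndex.
Variable G : groupType.
Implicit Types (Gamma : {pred G}).

(** Two powers of [x] lie in the same coset. Only the powers of [x] have to be
    covered by finitely many cosets: this weak form also helps to prove that an
    index is finite. *)
Lemma expg_in_subgroup Gamma (s : seq G) (x : G) :
    group_closed Gamma ->
    (forall k, exists2 t, t \in s & t^-1 * x ^+ k \in Gamma) ->
  exists n, x ^+ n.+1 \in Gamma.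
Proof.
move=> Gamma_gr sP.
have tP k : exists t : seq_sub s, (val t)^-1 * x ^+ k \in Gamma.
  by have [t ts tx] := sP k; exists (SeqSub ts).
have [t {}tP] := choice tP.
have [i [j [ltij tE]]] := nat_collision t.
exists (j - i).-1; rewrite prednK ?subn_gt0 //.
have -> : x ^+ (j - i) = ((val (t i))^-1 * x ^+ i)^-1 * ((val (t j))^-1 * x ^+ j).
  by rewrite -tE -{2}(subnKC (ltnW ltij)) expgnDr [X in _ * X]mulgA mulKg.
by apply: group_closedM => //; apply: group_closedV.
Qed.

Lemma independent_expg m (e : 'I_m -> G) (n : 'I_m -> nat) :
  Zindependent e -> Zindependent (fun i => e i ^+ (n i).+1).
Proof.
move=> e_ind k ke i; have := e_ind (fun i => (n i).+1%:Z * k i)%R.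
have -> : \prod_(i < m) expgz (e i) ((n i).+1%:Z * k i)%R =
          \prod_(i < m) expgz (e i ^+ (n i).+1) (k i).
  by apply: eq_bigr => i' _; rewrite expgzM.
by move=> /(_ ke i)/eqP; rewrite mulf_eq0 => /orP [//|/eqP].
Qed.

(** Some positive power of each element falls in a given subgroup of finite index, and
    powers of an independent family remain independent. *)
Lemma group_rank_of Gamma r :
    abelian_finite_index_subgroup Gamma -> abelian_rank Gamma r ->
  group_rank G r.
Proof.
move=> Gamma_afi Gamma_r; split=> [|Delta Delta_afi]; first by exists Gamma.
have push (B : {pred G}) m (e : 'I_m -> G) :
    abelian_finite_index_subgroup B -> Zindependent e ->
  exists2 e' : 'I_m -> G, forall i, e' i \in B & Zindependent e'.
- move=> [B_gr _ B_fi] e_ind.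
  have [s sP] := B_fi.
  have [n nP] := choice (fun i => expg_in_subgroup B_gr (fun k => sP (e i ^+ k))).
  by exists (fun i => e i ^+ (n i).+1) => //; apply: independent_expg.
have [[e [_ e_ind]] le_r] := Gamma_r.
split=> [|m e' _ e'_ind].
  by have [e' ? ?] := push Delta r e Delta_afi e_ind; exists e'.
by have [f fG f_ind] := push Gamma m e' Gamma_afi e'_ind; apply: le_r f_ind.
Qed.

Lemma abelian_rank_exists Gamma n :
    (forall m (e : 'I_m -> G),
       (forall i, e i \in Gamma) -> Zindependent e -> m <= n) ->
  exists2 r, r <= n & abelian_rank Gamma r.
Proof.
move=> le_n.
pose P m := `[< exists e : 'I_m -> G,
                  (forall i, e i \in Gamma) /\ Zindependent e >].
have P0 : exists m, P m.
  by exists 0; apply/asboolP; exists (fun=> 1); split=> [|k _] [].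
have Pn m : P m -> m <= n by move/asboolP=> [e [eG]]; apply: le_n eG.
case: (ex_maxnP P0 Pn) => r Pr r_max.
exists r; first exact: Pn.
split=> [|m e eG e_ind]; first exact/asboolP.
by apply/r_max/asboolP; exists e.
Qed.

End FiniteIndex.

(** * Actions of a presented group *)

Section PresentedGroup.
Variables (X : choiceType) (R : seq (X * bool) -> seq (X * bool) -> Prop).
Local Notation G := (presented_group R : groupType).

Definition pgen (x : X) : G := word_class R [:: (x, false)].

Lemma word_class_cat u v : word_class R (u ++ v) = word_class R u * word_class R v :> G.
Proof. by rewrite -[RHS]/(pres_mul _ _) pres_mulE. Qed.

Lemma pgenV x : (pgen x)^-1 = word_class R [:: (x, true)] :> G.
Proof.
apply: mulg1_eq; rewrite -word_class_cat -[RHS]/(word_class R [::]).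
exact/word_classP/(word_eq_cancel R (x, false)).
Qed.

Lemma presented_ind (P : G -> Prop) :
    P 1 -> (forall g x, P g -> P (g * pgen x)) ->
    (forall g x, P g -> P (g * (pgen x)^-1)) ->
  forall g, P g.
Proof.
move=> P1 PM PV g; rewrite -[g]word_class_repr.
elim/last_ind: (repr g) => [|u [x b] IHu]; first exact: P1.
rewrite -cats1 word_class_cat; case: b; last exact: PM.
by rewrite -pgenV; apply: PV.
Qed.

Section Action.
Variables (T : Type) (act : X * bool -> T -> T).

Definition word_act u t := foldr act t u.

Hypothesis actK : forall a, cancel (act (letter_inv a)) (act a).
Hypothesis act_rel : forall u v, R u v -> word_act u =1 word_act v.

(** The universal property, for actions on an arbitrary type: it produces both the
    action of the structure group on [X] and its counting cocycle. *)
Lemma word_act_eq u v : word_eq R u v -> word_act u =1 word_act v.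
Proof.
elim=> {u v} [u v /act_rel //|a t|//|u v _ IH t|u v w _ IHu _ IHv t|].
- exact: actK.
- by rewrite IH.
- by rewrite IHu.
by move=> u u' v v' _ IHu _ IHv t; rewrite /word_act !foldr_cat -!/(word_act _ _) IHv IHu.
Qed.

Definition pres_act (g : G) := word_act (repr g).

Lemma pres_act_class u : pres_act (word_class R u) =1 word_act u.
Proof. exact/word_act_eq/repr_word_class. Qed.

Lemma pres_act_gen x : pres_act (pgen x) =1 act (x, false).
Proof. exact: pres_act_class. Qed.

Lemma pres_act1 t : pres_act 1 t = t.
Proof. exact: (@pres_act_class [::]). Qed.

Lemma pres_actM g h t : pres_act (g * h) t = pres_act g (pres_act h t).
Proof. by rewrite [LHS]pres_act_class /word_act foldr_cat. Qed.

Lemma pres_actK g : cancel (pres_act g) (pres_act g^-1).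
Proof. by move=> t; rewrite -pres_actM mulVg pres_act1. Qed.

Lemma pres_actVK g : cancel (pres_act g^-1) (pres_act g).
Proof. by move=> t; rewrite -pres_actM mulgV pres_act1. Qed.

End Action.
End PresentedGroup.

(** * The structure group and its derived action *)

Section StructureGroup.
Variables (X : finType) (S : X * X -> X * X).
Hypotheses (S_braided : braided_set S) (S_nondeg : nondegenerate S).
Local Notation G := (structure_group S).
Local Notation g := (braid_g S).
Local Notation f := (braid_f S).
Local Notation gen := (pgen (structure_rel S)).
Implicit Types (a b : G) (x y z t : X) (w : seq X).

Lemma braid_g_inj x : injective (g x).
Proof. by apply: bij_inj; case: S_nondeg. Qed.

Lemma braidE x y : S (x, y) = (g x y, f y x).
Proof. by rewrite /braid_g /braid_f -surjective_pairing. Qed.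

Lemma braid_gM x y z : g x (g y z) = g (g x y) (g (f y x) z).
Proof.
have [_ /(_ (x, y, z))] := S_braided.
by rewrite /= !braidE /= !braidE /=; case.
Qed.

(** The braid relation says that [S2 S1] conjugates [S2] into [S1], hence the square
    of [S2] into that of [S1]; this compares first components. *)
Lemma braid_g_sq t x y :
  g t (S (S (x, y))).1 = (S (S (g t x, g (f x t) y))).1.
Proof.
have [_ braid] := S_braided.
pose p := (t, x, y); have eq1 := braid p; have eq2 := braid (braid2 S p).
have : braid1 S (braid1 S (braid2 S (braid1 S p))) =
       braid2 S (braid1 S (braid2 S (braid2 S p))).
  by rewrite [braid1 S (braid2 S (braid1 S p))]eq1 -[RHS]eq2.
by rewrite /p /= !braidE /= !braidE /=; case=> <-.
Qed.

Definition letter_act (l : X * bool) : X -> X :=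
  if l.2 then finv (g l.1) else g l.1.

Lemma letter_actK l : cancel (letter_act (letter_inv l)) (letter_act l).
Proof.
by case: l => x [] y /=; [apply: finv_f | apply: f_finv]; apply: braid_g_inj.
Qed.

Lemma letter_act_rel u v :
  structure_rel S u v -> word_act letter_act u =1 word_act letter_act v.
Proof. by case=> x [y [-> ->]] z; apply: braid_gM. Qed.

Definition gact a : X -> X := pres_act letter_act a.

Lemma gact_gen x : gact (gen x) =1 g x.
Proof. exact: (pres_act_gen letter_actK letter_act_rel). Qed.

Lemma gact1 x : gact 1 x = x.
Proof. exact: (pres_act1 letter_actK letter_act_rel). Qed.

Lemma gactM a b x : gact (a * b) x = gact a (gact b x).
Proof. exact: (pres_actM letter_actK letter_act_rel). Qed.

Lemma gactK a : cancel (gact a) (gact a^-1).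
Proof. exact: (pres_actK letter_actK letter_act_rel). Qed.

Lemma gactVK a : cancel (gact a^-1) (gact a).
Proof. exact: (pres_actVK letter_actK letter_act_rel). Qed.

Lemma gen_rel x y : gen x * gen y = gen (g x y) * gen (f y x).
Proof.
by rewrite -!word_class_cat; apply/word_classP/word_eq_rel; exists x, y.
Qed.

(** Conjugation by [z] in the derived group: [sigma z] is [x |-> g_z (f_y x)] with
    [y] such that [g_x y = z]. *)
Definition sigma z x : X := (S (S (x, gact (gen x)^-1 z))).1.

Lemma sigmaE x y : sigma (g x y) x = g (g x y) (f y x).
Proof. by rewrite /sigma -gact_gen gactK gact_gen braidE /=. Qed.

(** On generators this is [braid_g_sq]; so [G] acts by automorphisms of the rack
    with operation [sigma]. *)
Lemma gact_sigma a z x : gact a (sigma z x) = sigma (gact a z) (gact a x).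
Proof.
have gact_sigma_gen t x' z' : g t (sigma z' x') = sigma (g t z') (g t x').
  rewrite /sigma braid_g_sq; congr (S (S (_, _))).1.
  apply: (@braid_g_inj (g t x')).
  by rewrite -braid_gM -!gact_gen !gactVK.
elim/presented_ind: a z x => [|b t IHb|b t IHb] z x; rewrite ?gact1 // !gactM.
  by rewrite !gact_gen gact_sigma_gen IHb.
rewrite -IHb; congr (gact b _); apply: (can_inj (gactK (gen t))).
by rewrite gactVK gact_gen gact_sigma_gen -!gact_gen !gactVK.
Qed.

(** Right action on [G] of the derived group: [1 (+) x (+) y ...] is the element of
    [G] whose value under the bijective cocycle is the product of [x], [y], ... *)
Definition oplus a x : G := a * gen (gact a^-1 x).

Lemma gact_oplus a x : gact (oplus a x) =1 fun y => gact a (g (gact a^-1 x) y).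
Proof. by move=> y; rewrite gactM gact_gen. Qed.

Lemma mul_oplus b a x : b * oplus a x = oplus (b * a) (gact b x).
Proof. by rewrite /oplus invgM gactM gactK mulgA. Qed.

(** Both sides are [a] times a product of two generators, and the two products
    are related by [S]: the relation of [G] is the one of the derived group. *)
Lemma oplusC a x z : oplus (oplus a x) z = oplus (oplus a z) (sigma z x).
Proof.
set v := gact a^-1 x; pose u := gact (oplus a x)^-1 z.
have uE : g v u = gact a^-1 z.
  by apply: (can_inj (gactK a)); rewrite gactVK -gact_oplus gactVK.
rewrite -[LHS]/(a * gen v * gen u) -mulgA gen_rel uE mulgA -/(oplus a z).
rewrite -[RHS]/(oplus a z * gen _); congr (_ * gen _);
apply: (can_inj (gactK (oplus a z))).
by rewrite gactVK gact_oplus -uE -sigmaE uE gact_sigma !gactVK.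
Qed.

Lemma gact_expgz a k : gact a =1 id -> gact (expgz a k) =1 id.
Proof.
move=> ha; have hX n x : gact (a ^+ n) x = x.
  by elim: n => [|n IHn]; rewrite ?gact1 // expgS gactM IHn ha.
case: k => n x; first exact: hX.
by apply: (can_inj (gactK (a ^+ n.+1))); rewrite gactVK hX.
Qed.

Definition oplus_word a w : G := foldl oplus a w.

Lemma mul_oplus_word b a w : b * oplus_word a w = oplus_word (b * a) (map (gact b) w).
Proof. by elim: w a => [|x w IHw] a //=; rewrite IHw mul_oplus. Qed.

(** Derived group: [y z^k = z^k (sigma_z^k y)]. *)
Lemma oplus_word_swap_nseq a y z k :
  oplus_word (oplus a y) (nseq k z) = oplus (oplus_word a (nseq k z)) (iter k (sigma z) y).
Proof.
by elim: k a y => [|k IHk] a y //=; rewrite oplusC IHk -iterSr.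
Qed.

(** Derived group: conjugation by [z] applies [sigma z] to every letter. *)
Lemma oplus_word_swap a z w :
  oplus_word (oplus a z) (map (sigma z) w) = oplus (oplus_word a w) z.
Proof. by elim: w a => [|x w IHw] a //=; rewrite -oplusC IHw. Qed.

(** The element of [G] that corresponds to the power [x^k] in the derived group. *)
Definition genpow x k : G := oplus_word 1 (nseq k x).

Lemma gen_oplus y : gen y = oplus 1 y.
Proof. by rewrite /oplus invg1 gact1 mul1g. Qed.

(** The rightmost factor depends on [k] only through the action of [genpow z k] and
    [sigma_z^k]: it takes the same value at two exponents that collide. *)
Lemma gen_genpow y x k (z := gact (gen y) x) :
  gen y * genpow x k =
    genpow z k * gen (gact (genpow z k)^-1 (iter k (sigma z) y)).
Proof. by rewrite mul_oplus_word mulg1 {1}gen_oplus map_nseq oplus_word_swap_nseq. Qed.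

(** Derived group: [z (sigma_z x)^k = x^k z]. Since [gen_genpow] expands the same left
    side as [genpow (sigma z x) k] times a generator, comparing the two at the
    colliding exponents gives [kappa_sigma]. *)
Lemma gen_genpow_sigma z x k :
  gen z * genpow (gact (gen z)^-1 (sigma z x)) k =
    genpow x k * gen (gact (genpow x k)^-1 z).
Proof.
rewrite mul_oplus_word mulg1 map_nseq gactVK -map_nseq {1}gen_oplus.
exact: oplus_word_swap.
Qed.

(** Pigeonhole, with the letter [x] as a parameter so that one pair serves all letters. *)
Lemma genpow_collision : exists i j, [/\ i < j,
  forall x, gact (genpow x i) =1 gact (genpow x j) &
  forall x, iter i (sigma x) =1 iter j (sigma x)].
Proof.
pose F k := ([ffun p : X * X => gact (genpow p.1 k) p.2],
             [ffun p : X * X => iter k (sigma p.1) p.2]).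
have [i [j [ltij [/ffunP hE /ffunP sE]]]] := nat_collision F.
exists i, j; split=> // x y.
  by have := hE (x, y); rewrite !ffunE.
by have := sE (x, y); rewrite !ffunE.
Qed.

(** * The subgroup of central powers *)

Variables (i j : nat).
Hypotheses (ltij : i < j)
  (gact_ij : forall x, gact (genpow x i) =1 gact (genpow x j))
  (sigmaij : forall x, iter i (sigma x) =1 iter j (sigma x)).

Definition kappa x : G := genpow x j * (genpow x i)^-1.

Lemma kappa_genpow x : kappa x * genpow x i = genpow x j.
Proof. exact: mulgVK. Qed.

Lemma gact_kappa x : gact (kappa x) =1 id.
Proof. by move=> y; rewrite gactM -gact_ij gactVK. Qed.

Lemma gactV_ij x : gact (genpow x i)^-1 =1 gact (genpow x j)^-1.
Proof. by move=> y; apply: (can_inj (gactK (genpow x j))); rewrite gactVK -gact_ij gactVK. Qed.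

Lemma mul_kappa a x z v :
    a * genpow x i = genpow z i * v -> a * genpow x j = genpow z j * v ->
  a * kappa x = kappa z * a.
Proof.
move=> ai aj; rewrite mulgA aj /kappa -!mulgA; congr (_ * _).
by apply: (mulgI (genpow z i)); rewrite mulgA -ai mulgK mulVKg.
Qed.

(** In the derived group [kappa x] is the central element [x^(j - i)], so conjugation by
    [a] reduces to the action of [a] on [x]. *)
Lemma mul_kappa_swap a x : a * kappa x = kappa (gact a x) * a.
Proof.
have gen_kappa_swap y x' : gen y * kappa x' = kappa (gact (gen y) x') * gen y.
  by apply: mul_kappa; rewrite gen_genpow // gactV_ij sigmaij.
elim/presented_ind: a x => [|b y IHb|b y IHb] x.
- by rewrite gact1 mul1g mulg1.
- by rewrite -mulgA gen_kappa_swap mulgA IHb gactM mulgA.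
rewrite gactM [RHS]mulgA -IHb -(mulgA b (kappa _)) -(mulgA b); congr (b * _).
by apply: (mulgI (gen y)); rewrite mulVKg mulgA gen_kappa_swap gactVK mulgK.
Qed.

(** [x] and [sigma z x] are conjugate in the derived group, and their powers are
    central. *)
Lemma kappa_sigma z x : kappa (sigma z x) = kappa x.
Proof.
apply: (mulIg (gen z)); rewrite -[X in kappa X](gactVK (gen z)) -mul_kappa_swap.
by apply: mul_kappa; rewrite gen_genpow_sigma // gactV_ij.
Qed.

(** [kappa x] acts trivially on [X], hence on the other [kappa y] by conjugation. *)
Lemma kappa_commute x y : commute (kappa x) (kappa y).
Proof. by rewrite /commute mul_kappa_swap gact_kappa. Qed.

Definition Kappa : {pred G} := [pred a | `[< exists d, a = combination kappa d >]].

Lemma KappaP a : reflect (exists d, a = combination kappa d) (a \in Kappa).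
Proof. exact: asboolP. Qed.

Lemma Kappa_group : group_closed Kappa.
Proof.
split=> [|_ _ /KappaP [d ->] /KappaP [d' ->]]; apply/KappaP.
  by exists (fun=> 0%R); rewrite combination0.
by exists (fun x => d x - d' x)%R; rewrite combinationD ?combinationN //; apply: kappa_commute.
Qed.

Lemma kappa_in_Kappa x : kappa x \in Kappa.
Proof.
by apply/KappaP; exists (fun y => if y == x then 1 else 0)%R; rewrite combination_single.
Qed.

Lemma Kappa_abelian : {in Kappa &, forall a b, commute a b}.
Proof.
move=> _ _ /KappaP [d ->] /KappaP [d' ->].
exact/combination_commute/kappa_commute.
Qed.

Lemma Kappa_conj a b : b \in Kappa -> b ^ a \in Kappa.
Proof.
move=> /KappaP [d ->]; rewrite conjg_prod.
apply: (big_ind (fun c => c \in Kappa)); first by have [] := Kappa_group.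
  exact: (group_closedM Kappa_group).
move=> x _; apply/KappaP.
exists (fun y => if y == gact a^-1 x then d x else 0)%R; rewrite combination_single.
have <- : kappa x ^ a = kappa (gact a^-1 x) by rewrite conjgE mulgA mul_kappa_swap mulgVK.
by case: (d x) => n /=; rewrite ?conjVg conjXg.
Qed.

(** Occurrences of [x] move to the front, transforming the letters they cross; the
    letters equal to [x] are not crossed, so none is lost. *)
Lemma oplus_word_collect m x w : m <= count_mem x w ->
  exists2 w', size w = m + size w' &
    forall a, oplus_word a w = oplus_word (oplus_word a (nseq m x)) w'.
Proof.
elim: w m => [|y w IHw] [|m] // le_m; [by exists [::]|by exists (y :: w)|].
move: le_m; rewrite /=; case: eqVneq => [->|_]; rewrite ?add1n ?add0n => le_m.
  by have [w' sz_w wE] := IHw m le_m; exists w'; rewrite ?sz_w.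
have [w' sz_w wE] := IHw m.+1 le_m; exists (iter m.+1 (sigma x) y :: w') => [|a].
  by rewrite /= sz_w addnS.
by rewrite wE oplus_word_swap_nseq.
Qed.

(** The [j] copies of [x] collected in front become [kappa x] and [i] copies. *)
Lemma oplus_word_shorten x w : j <= count_mem x w ->
  exists2 w', size w' < size w & oplus_word 1 w = kappa x * oplus_word 1 w'.
Proof.
move=> /oplus_word_collect [w' -> ->]; exists (nseq i x ++ w').
  by rewrite size_cat size_nseq ltn_add2r.
rewrite /oplus_word foldl_cat -!/(oplus_word _ _) mul_oplus_word -/(genpow x j) -/(genpow x i).
by rewrite kappa_genpow (eq_map (gact_kappa x)) map_id.
Qed.

Lemma frequent_letter w : #|X| * j < size w -> exists x, j <= count_mem x w.
Proof.
have -> : size w = \sum_x count_mem x w.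
  elim: w => [|y w IHw] /=; first by rewrite big1.
  by rewrite big_split /= -IHw (bigD1 y) //= eqxx big1 // => x /negPf; rewrite eq_sym => ->.
rewrite -sum_nat_const => lt_sum; apply/existsP; apply: contraLR lt_sum.
by rewrite -leqNgt => /existsPn lt_j; apply: leq_sum => x _; rewrite ltnW // ltnNge.
Qed.

Lemma oplus_word_bounded w : exists2 w', size w' <= #|X| * j &
  (oplus_word 1 w')^-1 * oplus_word 1 w \in Kappa.
Proof.
have [n] := ubnP (size w); elim: n w => // n IHn w lt_w.
have [le_w|/frequent_letter [x /oplus_word_shorten [w1 lt_w1 ->]]] := leqP (size w) (#|X| * j).
  by exists w => //; rewrite mulVg; have [] := Kappa_group.
have [w' le_w' w'P] := IHn w1 (leq_trans lt_w1 lt_w).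
exists w' => //; rewrite -[kappa x * _](mulVKg (oplus_word 1 w1)) mulgA.
by apply: (group_closedM Kappa_group w'P); rewrite -conjgE; apply/Kappa_conj/kappa_in_Kappa.
Qed.

Lemma bounded_words n : exists s : seq (seq X), forall w, size w <= n -> w \in s.
Proof.
elim: n => [|n [s sP]]; first by exists [:: [::]] => w; rewrite leqn0 => /nilP ->.
exists ([::] :: [seq x :: w | x <- enum X, w <- s]) => -[|x w] //= /sP ws.
by rewrite inE allpairs_f ?mem_enum.
Qed.

Lemma oplus_word_rcons w x :
  oplus_word 1 (rcons w (gact (oplus_word 1 w) x)) = oplus_word 1 w * gen x.
Proof. by rewrite /oplus_word foldl_rcons -/(oplus_word _ _) /oplus gactK. Qed.

(** Every product of generators is [oplus_word 1 w] for some word [w]. Inverses of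
    generators are reduced to products: some positive power of each generator is
    in [Kappa]. *)
Lemma Kappa_finite_index : finite_index Kappa.
Proof.
have [Kap1 _] := Kappa_group; have KapM := group_closedM Kappa_group.
have [s0 s0P] := bounded_words (#|X| * j).
pose s := map (oplus_word 1) s0; exists s.
have s_word w : exists2 t, t \in s & t^-1 * oplus_word 1 w \in Kappa.
  by have [w' /s0P w's w'P] := oplus_word_bounded w; exists (oplus_word 1 w') => //; apply: map_f.
have genX x : exists n, gen x ^+ n.+1 \in Kappa.
  apply: (@expg_in_subgroup _ Kappa s) => [|k]; first exact: Kappa_group.
  suff [w <-] : exists w, oplus_word 1 w = gen x ^+ k by apply: s_word.
  elim: k => [|k [w wE]]; first by exists [::].
  by exists (rcons w (gact (oplus_word 1 w) x)); rewrite oplus_word_rcons wE expgSr.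
have [n nP] := choice genX.
have word_gen a x : (exists w, (oplus_word 1 w)^-1 * a \in Kappa) ->
    exists w, (oplus_word 1 w)^-1 * (a * gen x) \in Kappa.
  move=> [w wP]; exists (rcons w (gact (oplus_word 1 w) x)).
  by rewrite oplus_word_rcons invgM -mulgA [_ * (a * _)]mulgA -conjgE Kappa_conj.
have word_all a : exists w, (oplus_word 1 w)^-1 * a \in Kappa.
  elim/presented_ind: a => [|a x|a x aP]; [by exists [::]; rewrite mulVg|exact: word_gen|].
  have [w wP] : exists w, (oplus_word 1 w)^-1 * (a * gen x ^+ n x) \in Kappa.
    elim: (n x) => [|k IHk]; first by rewrite mulg1.
    by rewrite expgSr mulgA; apply: word_gen.
  exists w; have -> : (gen x)^-1 = gen x ^+ n x * gen x ^- (n x).+1.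
    by rewrite expgS invgM mulVKg.
  by rewrite (mulgA a) mulgA; apply/(KapM _ _ wP)/(group_closedV Kappa_group).
move=> a; have [w wP] := word_all a; have [t ts tP] := s_word w.
by exists t => //; rewrite -[a](mulVKg (oplus_word 1 w)) mulgA KapM.
Qed.

Lemma Kappa_afi : abelian_finite_index_subgroup Kappa.
Proof. split; [exact: Kappa_group|exact: Kappa_abelian|exact: Kappa_finite_index]. Qed.

Lemma Kappa_rank_le m (e : 'I_m -> G) :
  (forall k, e k \in Kappa) -> Zindependent e -> m <= #|X|.
Proof.
move=> eK; rewrite -cardsT; apply: independent_le; first exact: kappa_commute.
by move=> k; have /KappaP [d ->] := eK k; exists d => // x; rewrite inE.
Qed.

(** With [y = sigma z x], the equality [kappa y = kappa x] makes [y] superfluous as an index. *)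
Lemma Kappa_rank_lt z x m (e : 'I_m -> G) : sigma z x != x ->
  (forall k, e k \in Kappa) -> Zindependent e -> m < #|X|.
Proof.
set y := sigma z x => neq_yx eK e_ind.
rewrite -cardsT (cardsD1 y) inE ltnS.
apply: independent_le e_ind; first exact: kappa_commute.
move=> k; have /KappaP [d ->] := eK k.
(* The exponent of [y] is transferred to [x]. *)
pose dx y l : X -> int := fun t => if t == y then l else 0%R.
exists (fun t => d t + (dx x (d y) t + dx y (- d y) t))%R => [t|].
  rewrite !inE andbT negbK /dx => /eqP ->.
  by rewrite eqxx (negPf neq_yx) add0r subrr.
rewrite !combinationD; try exact: kappa_commute.
by rewrite !combination_single /y kappa_sigma -expgzD subrr mulg1.
Qed.

(** If [S^2] preserves first components, [S (S (S (x, y)))] and [S (x, y)] have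
    the same first component, and the maps [g x] are injective. *)
Lemma symmetric_setP : symmetric_set S <-> (forall z x, sigma z x = x).
Proof.
split=> [symS z x | sigma_id [x y]].
  by rewrite /sigma -[S (S _)]/((S \o S) _) symS.
have SS1 x' y' : (S (S (x', y'))).1 = x'.
  by rewrite braidE -[LHS]sigmaE sigma_id.
have x_eq := SS1 x y; have := SS1 (g x y) (f y x).
rewrite -braidE /= in x_eq *; case: (S (S (x, y))) x_eq => x' y' /= ->.
by move=> /braid_g_inj ->.
Qed.

(** * Independence in the symmetric case *)

Section Independence.
Hypothesis symS : symmetric_set S.

(** The action of [G] on [X] lifted to [X * int]: the generator [x] adds 1 to the integer
    exactly when it moves the point to [x]. The lift respects the relation for
    [x] and [y] because [S] is symmetric: one side counts at [x] and [g_x y], the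
    other at [g_x y] and [sigma_z x] with [z = g_x y]. *)
Definition count_act (l : X * bool) (p : X * int) : X * int :=
  if l.2 then (finv (g l.1) p.1, p.2 - (l.1 == p.1)%:Z)%R
  else (g l.1 p.1, p.2 + (l.1 == g l.1 p.1)%:Z)%R.

Lemma count_actK l : cancel (count_act (letter_inv l)) (count_act l).
Proof.
case: l => x [] [y n]; rewrite /count_act /=.
  by rewrite finv_f ?addrK //; apply: braid_g_inj.
by rewrite f_finv ?subrK //; apply: braid_g_inj.
Qed.

Lemma count_act_rel u v :
  structure_rel S u v -> word_act count_act u =1 word_act count_act v.
Proof.
case=> x [y [-> ->]] [z n]; rewrite /= /count_act /= -!/(g _ _) -!/(f _ _).
rewrite -!addrA; congr (_, n + _)%R; first exact: braid_gM.
have xE : g (g x y) (f y x) = x by rewrite -sigmaE (symmetric_setP.1 symS).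
rewrite addrC -(inj_eq (@braid_g_inj x) y) -[in RHS](inj_eq (@braid_g_inj (g x y)) (f y x)).
by rewrite xE -braid_gM.
Qed.

(** The multiplicity of [x] in the image of [a] under the cocycle from [G] to the free
    abelian group on [X]. *)
Definition count a x : int := (pres_act count_act a (gact a^-1 x, 0%R)).2.

Lemma count_actE a x n :
  pres_act count_act a (x, n) = (gact a x, n + (pres_act count_act a (x, 0)).2)%R.
Proof.
rewrite /gact /pres_act; elim: (repr a) n => [|[y b] w IHw] n; first by rewrite /= addr0.
rewrite ![word_act _ (_ :: _) _]/= IHw; case: (word_act count_act w (x, 0%R)) (IHw 0%R) => x' c [->] _.
by case: b; rewrite /count_act /= addrA.
Qed.

Lemma countM a b x : count (a * b) x = (count a x + count b (gact a^-1 x))%R.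
Proof.
rewrite /count invgM gactM (pres_actM count_actK count_act_rel) count_actE gactVK.
by rewrite count_actE /= addrC.
Qed.

Lemma count_gen x y : count (gen x) y = (x == y)%:Z%R.
Proof.
rewrite /count (pres_act_gen count_actK count_act_rel) /count_act /= add0r.
by rewrite -/(g _ _) -gact_gen gactVK.
Qed.

Lemma count1 x : count 1 x = 0%R.
Proof.
by have /esym/eqP := countM 1 1 x; rewrite mulg1 invg1 gact1 -subr_eq0 addrK => /eqP.
Qed.

Lemma count_oplus a x y : count (oplus a x) y = (count a y + (x == y)%:Z)%R.
Proof. by rewrite countM count_gen (inj_eq (can_inj (gactVK a))). Qed.

Lemma count_genpow x k y : count (genpow x k) y = (k%:Z * (x == y)%:Z)%R.
Proof.
have count_oplus_word a : count (oplus_word a (nseq k x)) y = (count a y + k%:Z * (x == y)%:Z)%R.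
  elim: k a => [|k IHk] a /=; first by rewrite mul0r addr0.
  by rewrite IHk count_oplus -addrA intS mulrDl mul1r.
by rewrite count_oplus_word count1 add0r.
Qed.

Lemma countM_trivial a b x : gact a =1 id -> count (a * b) x = (count a x + count b x)%R.
Proof. by move=> ha; rewrite countM -{2}[x]ha gactK. Qed.

Lemma count_kappa x y : count (kappa x) y = ((j - i)%:Z * (x == y)%:Z)%R.
Proof.
rewrite -subzn 1?ltnW // mulrBl -!count_genpow -kappa_genpow countM_trivial ?addrK //.
exact: gact_kappa.
Qed.

Lemma count_expgz a k x : gact a =1 id -> count (expgz a k) x = (k * count a x)%R.
Proof.
move=> ha.
have countX n : count (a ^+ n) x = (n%:Z * count a x)%R.
  elim: n => [|n IHn]; first by rewrite count1 mul0r.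
  by rewrite expgS countM_trivial // IHn intS mulrDl mul1r.
case: k => n; first exact: countX.
rewrite NegzE mulNr -countX; apply/eqP; rewrite -addr_eq0 addrC.
by rewrite -countM_trivial ?mulgV ?count1 //; apply: (@gact_expgz a n.+1).
Qed.

Lemma count_combination m (v : 'I_m -> X) (d : 'I_m -> int) x :
  count (\prod_(k < m) expgz (kappa (v k)) (d k)) x =
    (\sum_(k < m) d k * ((j - i)%:Z * (v k == x)%:Z))%R.
Proof.
elim: (index_enum _) => [|k s IHs]; first by rewrite !big_nil count1.
rewrite !big_cons countM_trivial ?IHs ?count_expgz ?count_kappa //; first exact: gact_kappa.
exact/gact_expgz/gact_kappa.
Qed.

Lemma kappa_independent : Zindependent (fun k : 'I_#|X| => kappa (enum_val k)).
Proof.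
move=> d d1 k; have := count_combination enum_val d (enum_val k).
rewrite d1 count1 (bigD1 k) //= eqxx mulr1 big1 ?addr0 => [/esym/eqP|l neq_lk].
  by rewrite mulf_eq0 eqz_nat subn_eq0 leqNgt ltij orbF => /eqP.
by rewrite (inj_eq enum_val_inj) (negPf neq_lk) !mulr0.
Qed.

End Independence.

Lemma braided_rank_structure : exists r,
  [/\ braided_rank S r, r <= #|X| & r = #|X| <-> symmetric_set S].
Proof.
have [r le_rX K_r] := abelian_rank_exists Kappa_rank_le.
exists r; split=> //; first exact: group_rank_of Kappa_afi K_r.
have [[e [eK e_ind]] r_max] := K_r.
split=> [rE | symS].
  apply/symmetric_setP => z x; apply/eqP; apply/negPn/negP => neq_x.
  by have := Kappa_rank_lt neq_x eK e_ind; rewrite rE ltnn.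
apply/eqP; rewrite eqn_leq le_rX; apply: r_max (kappa_independent symS) => k.
exact: kappa_in_Kappa.
Qed.

End StructureGroup.

Theorem corollary1 (X : finType) (S : X * X -> X * X)
    (X_nonempty : 0 < #|X|)
    (S_braided : braided_set S) (S_nondeg : nondegenerate S) :
  exists r : nat,
    [/\ braided_rank S r, r <= #|X| & r = #|X| <-> symmetric_set S].
Proof.
have [i [j [ltij gact_ij sigmaij]]] := genpow_collision S.
exact: braided_rank_structure gact_ij sigmaij.
Qed.
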